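(* Let $(r_n)_{n\ge 0}$ be a deterministic sequence with $0\le r_n<1$, and let $M=(M_n)_{n\ge 0}$ be a martingale with respect to a filtration $(\mathcal{G}_n)_{n\ge 0}$, taking values in $[0,1]$ and following the dynamics $$M_{n+1}=(1-r_n)M_n+r_nY_{n+1},\qquad n\ge 0,$$ where $Y_{n+1}$ is a random variable with values in $[0,1]$ and $E[Y_{n+1}\mid\mathcal{G}_n]=M_n$ a.s. Let $M_\infty$ be the almost sure limit of $(M_n)_n$, and set $P_{0,n}=P(M_\infty=0\mid\mathcal{G}_n)$ and $P_{1,n}=P(M_\infty=1\mid\mathcal{G}_n)$. Assume $\sum_n r_n^2<+\infty$. Then the random variables $$U_{0,n}=\exp\left(-\frac{2M_n^2}{\sum_{k=n}^{\infty}r_k^2}\right)\quad\text{and}\quad U_{1,n}=\exp\left(-\frac{2(1-M_n)^2}{\sum_{k=n}^{\infty}r_k^2}\right)$$ are almost sure upper bounds for $P_{0,n}$ and $P_{1,n}$ respectively (i.e. $P_{0,n}\le U_{0,n}$ and $P_{1,n}\le U_{1,n}$ a.s. for each $n$), and $$U_{0,n}-P_{0,n}\xrightarrow{a.s.}0\quad\text{and}\quad U_{1,n}-P_{1,n}\xrightarrow{a.s.}0\qquad (n\to\infty).$$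
   Context: Convention for the degenerate case $\sum_{k\ge n}r_k^2=0$: the fraction $a/0$ is read as $+\infty$ if $a>0$ (so the exponential is $0$) and as $0$ if $a=0$ (so the exponential is $1$). *)

(* Defs.v *)
From mathcomp Require Export all_boot all_order all_algebra.
From mathcomp Require Export all_classical all_reals all_analysis.
Export Order.TTheory GRing.Theory Num.Theory numFieldNormedType.Exports.

Set Implicit Arguments.
Unset Strict Implicit.
Unset Printing Implicit Defensive.

Local Open Scope classical_set_scope.
Local Open Scope ring_scope.

Section conditional_expectation.
Context (d : measure_display) (T : measurableType d) (R : realType).
Variable P : probability T R.
Implicit Types (G : set_system T) (F : nat -> set_system T) (X Z : T -> R).

Definition filtration F : Prop :=
  [/\ forall n, sigma_algebra setT (F n),
      forall n, F n `<=` measurable &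
      forall m n, (m <= n)%N -> F m `<=` F n].

(* [g_sigma_algebraType G] is [T] equipped with the sigma-algebra generated by
   [G], which is [G] itself when [G] is a sigma-algebra. *)
Definition measurable_wrt G X : Prop :=
  measurable_fun setT (X : g_sigma_algebraType G -> R).

(* Conditional expectation is unique only up to almost sure equality:
   [is_cond_exp G X Z] says that [Z] is a version of E[X | G], where [G] is
   meant to be a sub-sigma-algebra of the measurable sets. *)
Definition is_cond_exp G X Z : Prop :=
  [/\ P.-integrable setT (EFin \o X),
      P.-integrable setT (EFin \o Z),
      measurable_wrt G Z &
      forall A, G A -> (\int[P]_(w in A) (Z w)%:E = \int[P]_(w in A) (X w)%:E)%E].

Definition is_cond_prob G (A : set T) Z : Prop := is_cond_exp G \1_A Z.

Definition martingale F (M : nat -> T -> R) : Prop :=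
  [/\ forall n, measurable_wrt (F n) (M n),
      forall n, P.-integrable setT (EFin \o M n) &
      forall n, is_cond_exp (F n) (M n.+1) (M n)].

End conditional_expectation.

(* exp (- 2 a ^ 2 / \sum_(k >= n) r_k ^ 2).  The quotient is the one of the
   extended reals, where 0^-1 = +oo and 0 * +oo = 0: when the tail sum is 0 it
   is +oo if a != 0 and 0 if a = 0, and [expeR -oo = 0].  The argument of
   [expeR] is never positive, so its value is in [0, 1] and [fine] loses
   nothing. *)
Definition exp_tail_bound (R : realType) (r : nat -> R) (n : nat) (a : R) : R :=
  fine (expeR (- ((2 * a ^+ 2)%:E / \sum_(n <= k <oo) (r k ^+ 2)%:E)))%E.

(* Main.v *)
(** By convexity and Hoeffding's lemma, conditionally on [G n] the increment
    [r n * (Y n.+1 - M n)], supported in an interval of length [r n], satisfies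
    [E[exp (- l * M n.+1) | G n] <= exp (l ^+ 2 * r n ^+ 2 / 8) * exp (- l * M n)].
    Iterating and letting the time go to infinity, with [s] the tail sum of the
    [r k ^+ 2], [k >= n],
    [P(Minf = 0 | G n) <= exp (- l * M n + l ^+ 2 * s / 8)] for every [l >= 0];
    optimizing over [l] gives the bound [U0 n].  Off [Minf = 0] the bound tends
    to 0; on [Minf = 0] the conditional probabilities tend to 1 by Levy's 0-1 law,
    and both are squeezed.  Only this half of Levy's law is needed: if [A] is
    approximated by [C] in [G n] and [B] is the event that some [P(A | G m)] with
    [m >= n] falls below [1 - c], then decomposing [B] along the first such [m]
    gives [c * P(C `&` B) <= P(C `\` A)].  The statements about 1 are those about
    0 for [1 - M], [1 - Y] and [1 - Minf]. *)
From mathcomp Require Import measurable_realfun ring lra.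
Require Import Defs.

Set Implicit Arguments.
Unset Strict Implicit.
Unset Printing Implicit Defensive.

Local Open Scope classical_set_scope.
Local Open Scope ring_scope.

(** * Real-variable estimates: Hoeffding's lemma and the exponential bound *)

Lemma ge0_is_derive_le (R : realType) (f f' : R -> R) :
  (forall x, is_derive x (1 : R) f (f' x)) -> (forall x, 0 <= x -> 0 <= f' x) ->
  forall x, 0 <= x -> f 0 <= f x.
Proof.
move=> df f'_ge0 x x0; apply: (@ger0_derive1_ndecry _ f 0) => //.
- by move=> y; rewrite in_itv/= andbT => y0; rewrite derive1E derive_val f'_ge0// ltW.
- apply: continuous_subspaceT => y; apply: differentiable_continuous.
  by apply/derivable1_diffP.
Qed.

(** Hoeffding's lemma for a Bernoulli variable of mean [p], with Laplace transform [q]. The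
    logarithm [g] of the right side over the left one satisfies [g 0 = g' 0 = 0] and has nonnegative
    second derivative, so monotonicity applied twice gives [g >= 0]. *)
Lemma hoeffding_bernoulli (R : realType) (p s : R) : 0 <= p <= 1 -> 0 <= s ->
  1 - p + p * expR (- s) <= expR (s ^+ 2 / 8 - s * p).
Proof.
move=> /andP[p0 p1] s0.
pose q (x : R) : R := 1 - p + p * expR (- x).
have q_gt0 x : 0 < q x.
  rewrite /q; have := expR_gt0 (- x); have [->|p10] := eqVneq p 1; first lra.
  have : p < 1 by rewrite lt_neqAle p10.
  by move=> ? ?; apply: ltr_pwDl; [lra|apply: mulr_ge0 => //; exact: expR_ge0].
have dq x : is_derive x (1 : R) q (- (p * expR (- x))).
  rewrite /q; apply: is_derive_eq; rewrite /GRing.scale/=; ring.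
pose g' (x : R) : R := x / 4 - p + p * expR (- x) / q x.
have dg' x : is_derive x (1 : R) g' (4^-1 - (1 - p) * (p * expR (- x)) / q x ^+ 2).
  rewrite /g'; have q_neq0 := lt0r_neq0 (q_gt0 x).
  have := is_deriveV q_neq0 (dq x) => dqV.
  apply: is_derive_eq; rewrite /GRing.scale/= /q; field; exact: q_neq0.
have g'_ge0 x : 0 <= x -> 0 <= g' x.
  move=> x0; have <- : g' 0 = 0.
    by rewrite /g' /q oppr0 expR0 mulr1 subrK divr1 mul0r add0r addNr.
  apply: (ge0_is_derive_le dg') => // y y0.
  (* [q] is the sum of [1 - p] and [p * expR (- y)], so a quarter of its square minus their product
     is a quarter of the square of their difference. *)
  rewrite subr_ge0 ler_pdivrMr ?exprn_gt0// /q -subr_ge0.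
  rewrite (_ : _ - _ = 4^-1 * (1 - p - p * expR (- y)) ^+ 2); last by field.
  by rewrite mulr_ge0// ?sqr_ge0// invr_ge0.
pose g (x : R) : R := x ^+ 2 / 8 - x * p - ln (q x).
have dg x : is_derive x (1 : R) g (g' x).
  rewrite /g; have := is_derive1_comp (is_derive1_ln (q_gt0 x)) (dq x) => dlq.
  apply: is_derive_eq; rewrite /g' /GRing.scale/=; field; exact: lt0r_neq0.
have := ge0_is_derive_le dg g'_ge0 s0.
rewrite {1}/g expr0n/= !mul0r /q oppr0 expR0 mulr1 subrK ln1 addr0 subr0.
rewrite /g subr_ge0 => h.
by rewrite -[leLHS](@lnK _ _) ?ler_expR// posrE; exact: q_gt0.
Qed.

Lemma exp_tail_boundE (R : realType) (r : nat -> R) n (s a : R) :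
  (\sum_(n <= k <oo) (r k ^+ 2)%:E = s%:E)%E -> 0 <= s ->
  exp_tail_bound r n a =
  if s == 0 then (a == 0)%:R else expR (- (2 * a ^+ 2 / s)).
Proof.
move=> sE s0; rewrite /exp_tail_bound sE; case: eqP => [->|/eqP s_neq0].
  rewrite inve0; have [->|a0] := eqVneq a 0.
    by rewrite expr0n/= mulr0 mul0e oppe0 expeR0.
  have a2 : 0 < 2 * a ^+ 2 by rewrite mulr_gt0// exprn_even_gt0.
  rewrite gt0_muley ?lte_fin//=.
by rewrite inver (negbTE s_neq0).
Qed.

Lemma exp_tail_bound_itv (R : realType) (r : nat -> R) n (s a : R) :
  (\sum_(n <= k <oo) (r k ^+ 2)%:E = s%:E)%E -> 0 <= s ->
  0 <= exp_tail_bound r n a <= 1.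
Proof.
move=> sE s0; rewrite (exp_tail_boundE _ sE s0); case: eqP => _.
  by case: eqP; rewrite ?ler01 ?lexx.
by rewrite expR_ge0 -expR0 ler_expR oppr_le0 divr_ge0// mulr_ge0// sqr_ge0.
Qed.

(** The fractions [i / (j + 1)] are dense in the nonnegative reals. Bounds holding almost surely for
    each parameter hold simultaneously only for countably many of them; continuity recovers the
    others. *)
Lemma ge0_le_fun_grid (R : realType) (f : R -> R) (p : R) : continuous f ->
  (forall i j : nat, p <= f (i%:R / j.+1%:R)) -> forall x, 0 <= x -> p <= f x.
Proof.
move=> cf pf x x0.
(* [x] rounded down to a multiple of [1 / (j + 1)]. *)
pose u (j : nat) : R := (Num.trunc (x * j.+1%:R))%:R / j.+1%:R.
have ux : u @ \oo --> x.
  apply: (@squeeze_cvgr _ _ _ _ (fun j => x - j.+1%:R^-1) (cst x)).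
  - near=> j; have /andP[lo hi] := truncn_itv (mulr_ge0 x0 (ler0n R j.+1)).
    rewrite /u ler_pdivrMr ?ltr0n// lo andbT ler_pdivlMr ?ltr0n//.
    by rewrite mulrBl mulVf ?pnatr_eq0// lerBlDr natr1 ltW.
  - by rewrite -[X in _ --> X]subr0; apply: cvgB; [exact: cvg_cst|exact: cvg_harmonic].
  - exact: cvg_cst.
have fux : f (u j) @[j --> \oo] --> f x by apply: continuous_cvg => //; exact: cf.
by apply: (cvgr_to_ge fux); near=> j; exact: pf.
Unshelve. all: end_near. Qed.

(* Minimizing [- (l * a) + l ^+ 2 / 8 * s] over [0 <= l] gives [l = 4 * a / s]. *)
Lemma le_exp_tail_bound (R : realType) (r : nat -> R) n (s a p : R) :
  (\sum_(n <= k <oo) (r k ^+ 2)%:E = s%:E)%E -> 0 <= s -> 0 <= a ->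
  (forall l, 0 <= l -> p <= expR (- (l * a) + l ^+ 2 / 8 * s)) ->
  p <= exp_tail_bound r n a.
Proof.
move=> sE s0 a0 hp; rewrite (exp_tail_boundE _ sE s0); case: eqP => [s_eq0|/eqP s_neq0].
  have [a_eq0|a_neq0] := eqVneq a 0.
    by have := hp 0 (lexx _); rewrite !mul0r oppr0 expr0n/= !mul0r addr0 expR0.
  rewrite leNgt; apply/negP => p0.
  have a_gt0 : 0 < a by rewrite lt0r a_neq0.
  (* Degenerate case: if [p] were positive, [l = 1 / (p * a)] would give [p <= expR (- p^-1)],
     against [p^-1 < expR p^-1]. *)
  have l0 : 0 <= p^-1 / a by rewrite divr_ge0 ?invr_ge0 ?ltW.
  have := hp _ l0; rewrite s_eq0 mulr0 addr0 divfK// expRN leNgt => /negP; apply.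
  rewrite -[ltRHS]invrK ltf_pV2 ?posrE ?expR_gt0 ?invr_gt0//.
  by apply: lt_le_trans (expR_ge1Dx _); rewrite ltrDr.
have l0 : 0 <= 4 * a / s by rewrite divr_ge0// mulr_ge0.
apply: le_trans (hp _ l0) _; rewrite ler_expR le_eqVlt; apply/orP; left.
by apply/eqP; field.
Qed.

(** This is [expR (- x) <= 1 / x] at [x = 2 * a ^+ 2 / s]; the right side vanishes with [s] and also
    covers [s = 0]. *)
Lemma exp_tail_bound_le (R : realType) (r : nat -> R) n (s a : R) :
  (\sum_(n <= k <oo) (r k ^+ 2)%:E = s%:E)%E -> 0 <= s -> 0 < a ->
  exp_tail_bound r n a <= s / (2 * a ^+ 2).
Proof.
move=> sE s0 a0; rewrite (exp_tail_boundE _ sE s0); case: eqP => [->|/eqP s_neq0].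
  by rewrite gt_eqF// mul0r.
have s_gt0 : 0 < s by rewrite lt0r s_neq0.
have a2 : 0 < 2 * a ^+ 2 by rewrite mulr_gt0// exprn_gt0.
rewrite expRN -[leRHS]invf_div lef_pV2 ?posrE ?expR_gt0 ?divr_gt0//.
by apply: le_trans (expR_ge1Dx _); rewrite lerDr.
Qed.

Lemma fin_num_tail_sum (R : realType) (r : nat -> R) n :
  (\sum_(0 <= k <oo) (r k ^+ 2)%:E < +oo)%E ->
  exists2 s : R, (\sum_(n <= k <oo) (r k ^+ 2)%:E = s%:E)%E & 0 <= s.
Proof.
move=> hr; have r2 k : (0 <= (r k ^+ 2)%:E)%E by rewrite lee_fin sqr_ge0.
have S_ge0 m : (0 <= \sum_(m <= k <oo) (r k ^+ 2)%:E)%E by exact: nneseries_ge0.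
have S_fin : (\sum_(n <= k <oo) (r k ^+ 2)%:E)%E \is a fin_num.
  rewrite ge0_fin_numE//; apply: le_lt_trans hr.
  by rewrite (nneseries_split 0 n)// add0n leeDr// sume_ge0.
exists (fine (\sum_(n <= k <oo) (r k ^+ 2)%:E)%E); first by rewrite fineK.
exact: fine_ge0.
Qed.

Lemma exp_tail_bound_cvg0 (R : realType) (r a : nat -> R) (b : R) :
  (\sum_(0 <= n <oo) (r n ^+ 2)%:E < +oo)%E -> a @ \oo --> b -> 0 < b ->
  exp_tail_bound r n (a n) @[n --> \oo] --> 0.
Proof.
move=> hr ab b0.
pose s n : R := fine (\sum_(n <= k <oo) (r k ^+ 2)%:E)%E.
have sE n : (\sum_(n <= k <oo) (r k ^+ 2)%:E = (s n)%:E)%E /\ 0 <= s n.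
  by have [t tE t0] := fin_num_tail_sum n hr; rewrite /s tE.
have s0 : s @ \oo --> 0.
  apply: fine_cvg; apply: nneseries_tail_cvg => // k _.
  by rewrite lee_fin sqr_ge0.
apply: (@squeeze_cvgr _ _ _ _ (cst 0) (fun n => s n / (2 * a n ^+ 2))).
- near=> n; have [En s_ge0] := sE n.
  have an : 0 < a n by near: n; exact: (cvgr_gt b).
  rewrite (exp_tail_bound_le En)// andbT.
  by case/andP: (exp_tail_bound_itv (a n) En s_ge0).
- exact: cvg_cst.
- rewrite -[X in _ --> X](mul0r (2 * b ^+ 2)^-1); apply: cvgM => //.
  apply: cvgV; first by rewrite mulf_neq0// ?pnatr_eq0// expf_neq0// gt_eqF.
  by apply: cvgM; [exact: cvg_cst|rewrite expr2; apply: cvgM].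
Unshelve. all: end_near. Qed.

(** Convexity bounds the exponential by its chord over [[0, 1]]. The chord is affine in [y], so its
    conditional expectation depends only on that of [y]. *)
Lemma expR_le_chord (R : realType) (s y : R) : 0 <= y <= 1 ->
  expR (- (s * y)) <= 1 + - (1 - expR (- s)) * y.
Proof.
move=> /andP[y0 y1].
have h : expR (y * - s + (1 - y) * 0) <= y * expR (- s) + (1 - y) * expR 0.
  exact: (convex_expR (Itv01 y0 y1) (- s : R^o) 0).
rewrite mulr0 addr0 expR0 mulrN mulrC in h; apply: le_trans h _.
by rewrite le_eqVlt; apply/orP; left; apply/eqP; ring.
Qed.

(** * Conditional expectation and the conditional Hoeffding inequality *)

Section conditional_expectation_theory.
Context d (T : measurableType d) (R : realType) (P : probability T R).
Implicit Types (G : set_system T) (X Z W V : T -> R).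

(** Makes the closure properties of measurable sets available for membership in [G]. *)
Lemma measurable_sub_sigmaP G (A : set T) : sigma_algebra setT G ->
  @measurable _ (g_sigma_algebraType G) A <-> G A.
Proof. by move=> /sigma_algebra_id sG; rewrite -[in X in _ <-> X]sG. Qed.

Lemma measurable_wrt_preimage G X (B : set R) : sigma_algebra setT G ->
  measurable_wrt G X -> measurable B -> G (X @^-1` B).
Proof.
move=> sG mX mB; apply/(measurable_sub_sigmaP _ sG).
by have := mX measurableT B mB; rewrite setTI.
Qed.

Lemma measurable_wrt_fun G X : sigma_algebra setT G -> G `<=` measurable ->
  measurable_wrt G X -> measurable_fun [set: T] X.
Proof.
move=> sG Gm mX _ B mB; rewrite setTI; apply: Gm.
exact: measurable_wrt_preimage.
Qed.

Import HBNNSimple.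

(** Taking out what is known: for a simple [W] the integral over [A] splits along the level sets of
    [W], which lie in [G]; monotone convergence gives the general case. *)
Lemma integral_mul_sub_sigma G X Z W : sigma_algebra setT G -> G `<=` measurable ->
  measurable_fun setT X -> measurable_fun setT Z ->
  (forall t, 0 <= X t) -> (forall t, 0 <= Z t) -> (forall t, 0 <= W t) ->
  measurable_wrt G W ->
  (forall A, G A -> \int[P]_(t in A) (X t)%:E = \int[P]_(t in A) (Z t)%:E)%E ->
  forall A, G A ->
  (\int[P]_(t in A) (W t * X t)%:E = \int[P]_(t in A) (W t * Z t)%:E)%E.
Proof.
move=> sG Gm mX mZ X0 Z0 W0 mW XZ A GA.
have mA := Gm _ GA.
(* [W] is approximated as a function on [g_sigma_algebraType G], so that the level sets of each
   [h n] lie in [G]. *)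
have mEW : @measurable_fun _ _ (g_sigma_algebraType G) (\bar R) setT (EFin \o W).
  exact/measurable_EFinP.
pose h := nnsfun_approx measurableT mEW.
have hG n : measurable_wrt G (h n) by exact: measurable_funP.
have Gh n y : G (A `&` h n @^-1` [set y]).
  apply/(measurable_sub_sigmaP _ sG); apply: measurableI.
    exact/(measurable_sub_sigmaP _ sG).
  by apply/(measurable_sub_sigmaP _ sG); exact: measurable_wrt_preimage.
have mh n : measurable_fun [set: T] (h n) by exact: (measurable_wrt_fun sG).
(* The right side involves [V] only through its integrals over sets of [G], where [X] and [Z]
   agree. *)
have approxE V : measurable_fun setT V -> (forall t, 0 <= V t) ->
    (\int[P]_(t in A) (W t * V t)%:E = limn (fun n =>
      \sum_(y \in range (h n))
        (y%:E * \int[P]_(t in A `&` h n @^-1` [set y]) (V t)%:E)))%E.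
  move=> mV V0.
  have WE t : ((W t * V t)%:E = limn (fun n => (h n t * V t)%:E))%E.
    apply/esym/cvg_lim => //; apply: cvg_EFin; first by near=> n.
    apply: cvgMl; have := @cvg_nnsfun_approx _ _ _ _ measurableT _
      mEW (fun t _ => W0 t) t I.
    by move=> /fine_cvgP[].
  under eq_integral do rewrite WE.
  rewrite monotone_convergence//; last 3 first.
  - by move=> n; apply/measurable_EFinP/measurable_funTS/measurable_funM.
  - by move=> n t _; rewrite lee_fin mulr_ge0.
  - move=> t _ a b ab; rewrite lee_fin ler_wpM2r//.
    by have /lefP := nd_nnsfun_approx measurableT mEW ab; exact.
  congr (limn _); apply/funext => n.
  transitivity (\int[P]_(t in A) \sum_(y \in range (h n))
      (y * (\1_(h n @^-1` [set y]) t * V t))%:E)%E.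
    apply: eq_integral => t _; rewrite fsumEFin// fimfunE.
    rewrite mulr_fsuml; congr EFin.
    by apply: eq_fsbigr => y _; rewrite -mulrA.
  rewrite ge0_integral_fsum//; last 2 first.
  - move=> y; apply/measurable_EFinP; apply: measurable_funM => //.
    apply: measurable_funM; last exact: measurable_funTS.
    apply: measurable_indic; have := mh n measurableT _ (measurable_set1 y).
    by rewrite setTI.
  - move=> y t _; rewrite lee_fin indicE; case: (boolP (_ \in _)); last first.
      by rewrite mul0r mulr0.
    by rewrite inE mul1r => <-; rewrite mulr_ge0.
  apply: eq_fsbigr => y; rewrite inE => -[t0 _ <-].
  under eq_integral do rewrite EFinM.
  rewrite ge0_integralZl ?lee_fin//; last 2 first.
  - apply/measurable_EFinP; apply: measurable_funM; last exact: measurable_funTS.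
    apply: measurable_indic; have := mh n measurableT _ (measurable_set1 (h n t0)).
    by rewrite setTI.
  - by move=> t _; rewrite lee_fin mulr_ge0.
  congr (_ * _)%E; rewrite [RHS]integral_mkcondr; apply: eq_integral => t _.
  by rewrite patchE indicE; case: ifP => _; rewrite ?mul1r ?mul0r.
rewrite !approxE//; congr (limn _); apply/funext => n.
by apply: eq_fsbigr => y _; rewrite XZ.
Unshelve. all: end_near. Qed.

Lemma measurable_wrt_affine G X (a c : R) : measurable_wrt G X ->
  measurable_wrt G (fun t => a + c * X t).
Proof. by move=> mX; apply: measurable_funD => //; exact: measurable_funM. Qed.

Lemma integrable_affine X (a c : R) : P.-integrable setT (EFin \o X) ->
  P.-integrable setT (EFin \o (fun t => a + c * X t)).
Proof.
move=> iX; have icst := finite_measure_integrable_cst P a (@measurableT _ T).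
exact: (integrableD measurableT icst (integrableZl measurableT c iX)).
Qed.

Lemma integral_affine A X (a c : R) : measurable A ->
  P.-integrable setT (EFin \o X) ->
  (\int[P]_(t in A) (a + c * X t)%:E = a%:E * P A + c%:E * \int[P]_(t in A) (X t)%:E)%E.
Proof.
move=> mA iX.
have iXA : P.-integrable A (EFin \o X) by exact: integrableS iX.
have icst := finite_measure_integrable_cst P a mA.
rewrite -(integral_cst P mA) -(integralZl mA iXA).
exact: (integralD mA icst (integrableZl mA c iXA)).
Qed.

Lemma is_cond_exp_affine G X Z (a c : R) : G `<=` measurable ->
  is_cond_exp P G X Z ->
  is_cond_exp P G (fun t => a + c * X t) (fun t => a + c * Z t).
Proof.
move=> Gm [iX iZ mZ XZ]; split; [exact: integrable_affine..|
  exact: measurable_wrt_affine|] => A GA.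
by rewrite !integral_affine ?XZ//; exact: Gm.
Qed.

Lemma is_cond_exp_onem G X Z : G `<=` measurable -> is_cond_exp P G X Z ->
  is_cond_exp P G (fun t => 1 - X t) (fun t => 1 - Z t).
Proof.
move=> Gm; have onemE V : (fun t => 1 - V t) = (fun t => 1 + - 1 * V t).
  by apply/funext => t; rewrite mulN1r.
by rewrite !onemE; exact: is_cond_exp_affine.
Qed.

(** The event [A] where [Z < X] lies in [G]. The integral of [X - Z] over it is at most 0 with a
    positive integrand, so [A] is negligible. *)
Lemma ae_le_sub_sigma G X Z : sigma_algebra setT G -> G `<=` measurable ->
  measurable_wrt G X -> measurable_wrt G Z ->
  P.-integrable setT (EFin \o X) -> P.-integrable setT (EFin \o Z) ->
  (forall A, G A -> \int[P]_(t in A) (X t)%:E <= \int[P]_(t in A) (Z t)%:E)%E ->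
  \forall t \ae P, X t <= Z t.
Proof.
move=> sG Gm mX mZ iX iZ XZ.
pose A := (X \- Z) @^-1` `]0, +oo[.
have GA : G A by apply: measurable_wrt_preimage => //; exact: measurable_funB.
have mA := Gm _ GA.
have iXA : P.-integrable A (EFin \o X) by exact: integrableS iX.
have iZA : P.-integrable A (EFin \o Z) by exact: integrableS iZ.
have iXZ : P.-integrable A (EFin \o (X \- Z)) by exact: (integrableB mA iXA iZA).
have AE t : A t = (0 < X t - Z t) :> Prop by rewrite /A/= in_itv/= andbT.
have XZ0 : (\int[P]_(t in A) `|(X t - Z t)%:E| = 0)%E.
  apply/eqP; rewrite eq_le integral_ge0 ?andbT//.
  rewrite (eq_integral (fun t => (EFin \o X) t - (EFin \o Z) t)%E); last first.
    by move=> t /set_mem; rewrite AE => /ltW At; rewrite gee0_abs ?lee_fin//.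
  by rewrite integralB// sube_le0 XZ.
have /(ae_eq_integral_abs P mA (measurable_int P iXZ)) := XZ0.
apply: filterS => t /= At0; rewrite leNgt; apply/negP => ZX.
have At : A t by rewrite AE subr_gt0.
by have [] := At0 At; move/eqP; rewrite subr_eq0 gt_eqF.
Qed.

(** The domain is left general so as to serve both for [T] and for [T] with the sigma-algebra
    [G]. *)
Lemma measurable_fun_expRM d' (T' : measurableType d') (X : T' -> R) (c : R) :
  measurable_fun setT X -> measurable_fun setT (fun t => expR (c * X t)).
Proof.
by move=> mX; apply: measurableT_comp => //; exact: measurable_funM.
Qed.
(** The conditional inequality is tested on sets of [G]. The factor [W] of [expR (- l * M')] is
    known at the present time; in the other one, the chord bound lets [Y] be replaced by its
    conditional mean [M]. *)
Lemma hoeffding_step G M M' Y (r l : R) : sigma_algebra setT G -> G `<=` measurable ->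
  0 <= r <= 1 -> 0 <= l ->
  (forall t, 0 <= M t <= 1) -> (forall t, 0 <= Y t <= 1) -> measurable_fun setT M' ->
  is_cond_exp P G Y M -> (\forall t \ae P, M' t = (1 - r) * M t + r * Y t) ->
  forall A, G A ->
  (\int[P]_(t in A) (expR (- l * M' t))%:E <=
   (expR (l ^+ 2 / 8 * r ^+ 2))%:E * \int[P]_(t in A) (expR (- l * M t))%:E)%E.
Proof.
move=> sG Gm /andP[r0 r1] l0 M01 Y01 mM' YM dyn A GA.
have mA := Gm _ GA.
have lr0 : 0 <= l * r by exact: mulr_ge0.
pose W t := expR (- (l * (1 - r)) * M t).
pose e : R := 1 - expR (- (l * r)).
have e01 : 0 <= e <= 1.
  by rewrite /e lerBlDr lerDl expR_ge0 subr_ge0 -expR0 ler_expR oppr_le0 lr0.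
have lin_ge0 y : 0 <= y <= 1 -> 0 <= 1 + - e * y.
  by move=> /andP[y0 y1]; case/andP: e01 => ? ?; rewrite mulNr subr_ge0 mulr_ile1.
have [iY' iM' mM'G YM'] := is_cond_exp_affine 1 (- e) Gm YM.
have [iY iM mMG _] := YM.
have mM := measurable_wrt_fun sG Gm mMG.
have mY : measurable_fun setT Y by exact/measurable_EFinP/(measurable_int P iY).
have mYe : measurable_fun setT (fun t => 1 + - e * Y t).
  by exact/measurable_EFinP/(measurable_int P iY').
have mMe := measurable_wrt_fun sG Gm mM'G.
apply: (@le_trans _ _ (\int[P]_(t in A) (W t * (1 + - e * Y t))%:E)%E).
  apply: ae_ge0_le_integral => //.
  - by apply/measurable_EFinP/measurable_funTS/measurable_fun_expRM.
  - by move=> t _; rewrite lee_fin mulr_ge0 ?expR_ge0 ?lin_ge0.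
  - apply/measurable_EFinP/measurable_funTS/measurable_funM => //.
    exact: measurable_fun_expRM.
  - apply: filterS dyn => t -> _; rewrite lee_fin.
    have -> : - l * ((1 - r) * M t + r * Y t) =
      - (l * (1 - r)) * M t + - (l * r * Y t) by ring.
    by rewrite expRD ler_wpM2l ?expR_ge0// expR_le_chord.
have WG : measurable_wrt G W by exact: measurable_fun_expRM.
(* Conditioning on [G] with the weight [W] turns [Y] into [M]. *)
rewrite (integral_mul_sub_sigma sG Gm mYe mMe (fun t => lin_ge0 _ (Y01 t))
  (fun t => lin_ge0 _ (M01 t)) (fun t => expR_ge0 _) WG _ GA); last first.
  by move=> B GB; rewrite YM'.
rewrite -ge0_integralZl//; last first.
  by apply/measurable_EFinP/measurable_funTS/measurable_fun_expRM.
apply: ge0_le_integral => //.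
- by move=> t _; rewrite lee_fin mulr_ge0 ?expR_ge0 ?lin_ge0.
- apply/measurable_EFinP/measurable_funTS/measurable_funM => //.
  exact: measurable_fun_expRM.
- under eq_fun do rewrite -EFinM.
  apply/measurable_EFinP/measurable_funTS/measurable_funM => //.
  exact: measurable_fun_expRM.
- move=> t _; rewrite -EFinM lee_fin -expRD.
  (* The exponent is split so that Hoeffding's lemma applies with mean [M t] and parameter
     [l * r]. *)
  have -> : l ^+ 2 / 8 * r ^+ 2 + - l * M t = - (l * (1 - r)) * M t +
    ((l * r) ^+ 2 / 8 - (l * r) * M t) by field.
  rewrite expRD ler_wpM2l ?expR_ge0//.
  apply: le_trans (hoeffding_bernoulli (M01 t) lr0).
  by rewrite /e le_eqVlt; apply/orP; left; apply/eqP; ring.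
Qed.

End conditional_expectation_theory.

(** * Levy's 0-1 law on an approximable event *)

Section levy.
Context d (T : measurableType d) (R : realType) (P : probability T R).

Lemma probability_cvg0 (S : nat -> set T) : (forall n, measurable (S n)) ->
  (\forall t \ae P, \forall n \near \oo, ~ S n t) -> P (S n) @[n --> \oo] --> 0%E.
Proof.
move=> mS evS.
have [] := @dominated_convergence _ _ _ P setT measurableT
  (fun n t => (\1_(S n) t)%:E) (cst 0%E) (EFin \o cst 1).
- by move=> n; apply/measurable_EFinP/measurable_indic.
- exact: measurable_cst.
- apply: filterS evS => t evt _; apply: cvg_near_cst.
  by apply: filterS evt => n Snt; rewrite indicE memNset.
- exact: finite_measure_integrable_cst.
- apply: aeW => t n _; rewrite gee0_abs ?lee_fin ?indicE ?ler0n//.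
  by case: (_ \in _).
move=> _ _; rewrite integral0; under eq_fun do rewrite integral_indic// setIT.
by [].
Qed.

Section first_passage.
Variables (G : nat -> set_system T) (N : nat -> T -> R) (A : set T).
Hypothesis filG : filtration G.
Hypothesis mA : measurable A.
Hypothesis NE : forall n, is_cond_prob P (G n) A (N n).

Let sG n : sigma_algebra setT (G n). Proof. by case: filG. Qed.
Let Gm n : G n `<=` measurable. Proof. by case: filG. Qed.
Let GS n m : (n <= m)%N -> G n `<=` G m. Proof. by case: filG => _ _; apply. Qed.

Let low c n := [set t | N n t < 1 - c].

Let Glow c n : G n (low c n).
Proof.
have [_ _ mN _] := NE n.
have -> : low c n = N n @^-1` `]-oo, 1 - c[.
  by apply/seteqP; split=> t; rewrite /low/= in_itv.
exact: measurable_wrt_preimage.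
Qed.

(** On [D] the conditional probability of the complement of [A] exceeds [c]; it is integrated over
    [D], a set of [G n]. *)
Let P_low c n D : 0 <= c -> G n D -> D `<=` low c n ->
  (c%:E * P D <= P (D `\` A))%E.
Proof.
move=> c0 GD Dlow; have mD := Gm GD.
have [iA iN _ NI] := is_cond_exp_affine 1 (- 1) (@Gm n) (NE n).
rewrite -(integral_cst P mD) setDE setIC -integral_indic//; last exact: measurableC.
rewrite [leRHS](eq_integral (fun t => (1 + - 1 * \1_A t)%:E)) => [|t _]; last first.
  by rewrite !indicE in_setC; case: (_ \in _) => /=; congr EFin; ring.
rewrite -NI//; apply: ge0_le_integral => //.
- by apply: measurable_funTS; exact: (measurable_int P iN).
- by move=> t /Dlow; rewrite /low/= lee_fin => ?; lra.
Qed.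

(** [seqDU F k] is the part of [C] where the first passage below [1 - c] from time [n] on occurs at
    [n + k]. It lies in [G (n + k)] because the filtration increases, and the previous bound is
    summed over these disjoint pieces. *)
Let P_first_passage c n C : 0 <= c -> G n C ->
  (c%:E * P (C `&` \bigcup_k low c (n + k)) <= P (C `\` A))%E.
Proof.
move=> c0 GC; have mC := Gm GC.
pose F k := C `&` low c (n + k).
have GF i k : (i <= k)%N -> G (n + k)%N (F i).
  move=> ik; apply/(measurable_sub_sigmaP _ (sG _)); apply: measurableI.
    by apply/(measurable_sub_sigmaP _ (sG _)); apply: GS GC; exact: leq_addr.
  apply/(measurable_sub_sigmaP _ (sG _)); apply: (GS _ (Glow c (n + i))).
  by rewrite leq_add2l.
have GD k : G (n + k)%N (seqDU F k).
  apply/(measurable_sub_sigmaP _ (sG _)); apply: measurableD.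
    by apply/(measurable_sub_sigmaP _ (sG _)); exact: GF.
  apply: bigsetU_measurable => i _.
  by apply/(measurable_sub_sigmaP _ (sG _)); apply: GF; exact: ltnW.
have mD k : measurable (seqDU F k) by exact: Gm (GD k).
have mDA k : measurable (seqDU F k `\` A) by exact: measurableD.
rewrite setI_bigcupr -[\bigcup_(i in _) _]/(\bigcup_k F k) seqDU_bigcup_eq.
rewrite measure_semi_bigcup//; last exact: bigcup_measurable.
rewrite -nneseriesZl//.
apply: (@le_trans _ _ (\sum_(0 <= k <oo) P (seqDU F k `\` A))%E).
  apply: lee_nneseries => [k Nk Pk|k Pk]; first by rewrite mule_ge0.
  apply: (P_low c0 (GD k)) => t Dt.
  by have [] := @subset_seqDU _ F k t Dt.
rewrite -measure_semi_bigcup//; last 2 first.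
- move=> i j _ _ [t [[Di _] [Dj _]]].
  by apply: (trivIset_seqDU F) => //; exists t.
- exact: bigcup_measurable.
apply: le_measure; rewrite ?inE//; [exact: bigcup_measurable|exact: measurableD|].
by move=> t [k _ [Dt nAt]]; have [] := @subset_seqDU _ F k t Dt.
Qed.

(** The approximation hypothesis stands for measurability of [A], up to null sets, with respect to
    all the [G n] together. *)
Lemma levy_liminf_cond_prob :
  (forall e : R, 0 < e -> exists n C, [/\ G n C, (P (A `\` C) <= e%:E)%E &
     (P (C `\` A) <= e%:E)%E]) ->
  forall c, 0 < c -> \forall t \ae P, A t -> \forall n \near \oo, 1 - c <= N n t.
Proof.
move=> approxA c c0.
have mlow n : measurable (low c n) by exact: Gm (Glow c n).
(* The part of [A] on which the conditional probabilities fall below [1 - c] infinitely often. *)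
pose E := A `&` \bigcap_n \bigcup_k low c (n + k).
have mE : measurable E.
  apply: measurableI => //; apply: bigcap_measurable => // n _.
  exact: bigcup_measurable.
have E0 : P E = 0%E.
  apply/eqP; rewrite -measure_le0; apply/lee_addgt0Pr => e e0; rewrite add0e.
  (* [E] is covered by [A] minus [C] and by the passage event inside [C]. If the approximation error
     is [a], these weigh at most [a] and [a / c], whence the factor [1 + c^-1]. *)
  have k0 : 0 < 1 + c^-1 by rewrite addr_gt0// invr_gt0.
  have [n [C [GC AC CA]]] := approxA (e / (1 + c^-1)) (divr_gt0 e0 k0).
  have mC := Gm GC.
  have mB : measurable (C `&` \bigcup_k low c (n + k)).
    by apply: measurableI => //; exact: bigcup_measurable.
  apply: (@le_trans _ _ (P ((A `\` C) `|` (C `&` \bigcup_k low c (n + k))))).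
    apply: le_measure; rewrite ?inE//.
      by apply: measurableU => //; exact: measurableD.
    by move=> t [At /(_ n I) Bt]; have [Ct|Ct] := pselect (C t); [right|left].
  apply: le_trans (measureU2 _ _ _) _ => //; first exact: measurableD.
  have -> : e = e / (1 + c^-1) + c^-1 * (e / (1 + c^-1)).
    by field; rewrite !gt_eqF ?addr_gt0.
  rewrite EFinD; apply: leeD => //.
  rewrite EFinM lee_pdivlMl//.
  exact: le_trans (P_first_passage (ltW c0) GC) CA.
exists E; split => // t /= /not_implyP[At nevt]; split => // n _.
apply: contrapT => nlow; apply: nevt; exists n => // m /= nm.
rewrite leNgt; apply/negP => lowm; apply: nlow; exists (m - n)%N => //.
by rewrite subnKC.
Qed.

End first_passage.

(** The approximating event is [M n <= D]. First [D] is taken so small that [0 < Minf <= D] is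
    unlikely, then [n] so large that [M n] and [Minf] rarely lie on different sides of [D]. *)
Lemma approx_limit_eq0 (G : nat -> set_system T) (M : nat -> T -> R) (Minf : T -> R) :
  filtration G -> (forall n, measurable_wrt (G n) (M n)) ->
  (forall n t, 0 <= M n t) -> measurable_fun setT Minf ->
  (\forall t \ae P, M n t @[n --> \oo] --> Minf t) ->
  forall e : R, 0 < e -> exists n C, [/\ G n C,
    (P ([set t | Minf t = 0%R] `\` C) <= e%:E)%E &
    (P (C `\` [set t | Minf t = 0%R]) <= e%:E)%E].
Proof.
move=> [sG Gm GS] mGM M0 mMinf cvgM e e0.
have mM n : measurable_fun setT (M n).
  exact: (measurable_wrt_fun (sG n) (@Gm n) (@mGM n)).
have mMi n (B : set R) : measurable B -> measurable (M n @^-1` B).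
  by move=> mB; have := mM n measurableT B mB; rewrite setTI.
have mMif (B : set R) : measurable B -> measurable (Minf @^-1` B).
  by move=> mB; have := mMinf measurableT B mB; rewrite setTI.
have small (S : nat -> set T) (a : R) : 0 < a -> (forall n, measurable (S n)) ->
    (\forall t \ae P, \forall n \near \oo, ~ S n t) ->
    \forall n \near \oo, (P (S n) <= a%:E)%E.
  move=> a0 mS evS; have PS0 := probability_cvg0 mS evS.
  have a_nbhs : nbhs (0%E : \bar R) [set x | (x < a%:E)%E].
    by apply: open_ereal_lt'; rewrite lte_fin.
  by near=> n; apply: ltW; near: n; exact: (PS0 _ a_nbhs).
have e2 : 0 < e / 2 by rewrite divr_gt0.
have e2e : ((e / 2)%:E <= e%:E)%E.
  by rewrite lee_fin ler_pdivrMr// ler_peMr// ?ler1n// ltW.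
have [j Pj] : exists j, (P (Minf @^-1` `]0%R, j.+1%:R^-1%R]) <= (e / 2)%:E)%E.
  apply: (@filter_ex _ \oo); apply: small => // [n|]; first exact: mMif.
  apply: aeW => t; have [t0|t0] := ltP 0 (Minf t).
    have small_inv : \forall n \near \oo, n.+1%:R^-1 < Minf t.
      exact: (cvgr_lt _ (@cvg_harmonic R)).
    near=> n; rewrite /= in_itv/= t0/=; apply/negP; rewrite -ltNge.
    by near: n.
  by near=> n; rewrite /= in_itv/= ltNge t0.
pose D : R := j.+1%:R^-1.
have D0 : 0 < D by rewrite invr_gt0.
pose S2 n := [set t | Minf t = 0] `&` M n @^-1` `]D, +oo[.
(* The complement of [[0, D]] includes negative values, since [Minf] is nonnegative only almost
   surely while the final inclusion is pointwise. *)
pose S3 n := M n @^-1` `]-oo, D] `&` Minf @^-1` (~` `[0, D]).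
have [n [P2 P3]] : exists n, ((P (S2 n) <= (e / 2)%:E) /\ (P (S3 n) <= (e / 2)%:E))%E.
  apply: (@filter_ex _ \oo); apply: filterI; (apply: small => //; first move=> n).
  - apply: measurableI; last exact: mMi.
    exact: (mMif [set 0] (measurable_set1 0)).
  - apply: filterS cvgM => t cMt.
    have [t0|/eqP t0] := eqVneq (Minf t) 0; last by near=> n; case.
    have MD : \forall n \near \oo, M n t < D by apply: (cvgr_lt _ cMt); rewrite t0.
    apply: filterS MD => n Mn [_].
    by rewrite /= in_itv/= andbT ltNge (ltW Mn).
  - by apply: measurableI; [exact: mMi|apply: mMif; exact: measurableC].
  - apply: filterS cvgM => t cMt.
    have t0 : 0 <= Minf t by apply: (cvgr_to_ge cMt); near=> n; exact: M0.
    have [tD|Dt] := leP (Minf t) D.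
      by near=> n => -[_]; apply; rewrite /= in_itv/= t0 tD.
    have DM : \forall n \near \oo, D < M n t by exact: (cvgr_gt _ cMt).
    apply: filterS DM => n Mn [].
    by rewrite /= in_itv/= leNgt Mn.
exists n, (M n @^-1` `]-oo, D]); split.
- exact: measurable_wrt_preimage.
- apply: le_trans e2e; apply: le_trans P2.
  rewrite (_ : _ `\` _ = S2 n)//; apply/seteqP; split=> t [At] /=.
    rewrite in_itv/= => /negP; rewrite -ltNge => Dt; split => //=.
    by rewrite in_itv/= Dt.
  by rewrite in_itv/= andbT => Dt; split => //=; rewrite in_itv/= leNgt Dt.
- have mS3 : measurable (S3 n).
    by apply: measurableI; [exact: mMi|apply: mMif; exact: measurableC].
  have mS1 : measurable (Minf @^-1` `]0, D]) by exact: mMif.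
  apply: (@le_trans _ _ (P (S3 n `|` Minf @^-1` `]0, D]))).
    apply: le_measure; rewrite ?inE//; last 2 first.
    + exact: measurableU.
    + move=> t [Ct t0] /=.
      have [tD|tD] := pselect (t \in Minf @^-1` `[0, D]); last first.
        by left; split => // h; apply: tD; rewrite inE.
      right; move: tD; rewrite inE /= !in_itv/= => /andP[t0' ->]; rewrite andbT.
      by rewrite lt0r t0' andbT; apply/eqP.
    + apply: measurableD; first exact: mMi.
      exact: (mMif [set 0] (measurable_set1 0)).
  apply: le_trans (measureU2 _ _ _) _ => //.
  by rewrite [e in leRHS]splitr EFinD leeD.
Unshelve. all: end_near. Qed.

End levy.

(** * The bound and the convergence for the limit value 0 *)

Section one_sided_bound.
Context d (T : measurableType d) (R : realType) (P : probability T R).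
Variables (r : nat -> R) (G : nat -> set_system T) (M Y : nat -> T -> R).
Variables (Minf : T -> R) (P0 : nat -> T -> R).
Hypothesis r01 : forall n, 0 <= r n < 1.
Hypothesis filG : filtration G.
Hypothesis M01 : forall n t, 0 <= M n t <= 1.
Hypothesis Y01 : forall n t, 0 <= Y n.+1 t <= 1.
Hypothesis YM : forall n, is_cond_exp P (G n) (Y n.+1) (M n).
Hypothesis dynM : forall n,
  \forall t \ae P, M n.+1 t = (1 - r n) * M n t + r n * Y n.+1 t.
Hypothesis mMinf : measurable_fun setT Minf.
Hypothesis cvgM : \forall t \ae P, M n t @[n --> \oo] --> Minf t.
Hypothesis P0E : forall n, is_cond_prob P (G n) [set t | Minf t = 0] (P0 n).
Hypothesis sum_r2 : (\sum_(0 <= n <oo) (r n ^+ 2)%:E < +oo)%E.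

Let sG n : sigma_algebra setT (G n). Proof. by case: filG. Qed.
Let Gm n : G n `<=` measurable. Proof. by case: filG. Qed.
Let GS n m : (n <= m)%N -> G n `<=` G m. Proof. by case: filG => _ _; apply. Qed.

Let mGM n : measurable_wrt (G n) (M n). Proof. by case: (YM n). Qed.

Let mM n : measurable_fun setT (M n).
Proof. exact: (measurable_wrt_fun (sG n) (@Gm n) (@mGM n)). Qed.

Let m0 : measurable [set t | Minf t = 0].
Proof. by have := mMinf measurableT (measurable_set1 0); rewrite setTI. Qed.

(** The one-step bound is iterated on a fixed [A], which remains in every later sigma-algebra. *)
Lemma hoeffding_iter l n k A : 0 <= l -> G n A ->
  (\int[P]_(t in A) (expR (- l * M (n + k)%N t))%:E <=
   (expR (l ^+ 2 / 8 * \sum_(n <= i < n + k) r i ^+ 2))%:E *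
   \int[P]_(t in A) (expR (- l * M n t))%:E)%E.
Proof.
move=> l0 GA; elim: k => [|k ih].
  by rewrite addn0 big_geq// mulr0 expR0 mul1e.
rewrite addnS big_nat_recr ?leq_addr//= mulrDr addrC expRD EFinM -muleA.
have GkA : G (n + k)%N A by apply: GS GA; exact: leq_addr.
have r01' : 0 <= r (n + k)%N <= 1 by have /andP[-> /ltW ->] := r01 (n + k).
apply: le_trans (hoeffding_step (sG _) (@Gm _) r01' l0 (M01 _) (Y01 _) (@mM _) (YM _)
  (dynM _) GkA) _.
by rewrite lee_pmul2l// lte_fin expR_gt0.
Qed.

(** Chernoff's argument: the indicator of [Minf = 0] is at most [expR (- l * Minf)]. Dominated
    convergence, with constant 1, passes to the limit in the iterated bound, whose partial sums are
    at most [s]. *)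
Lemma integral_limit_eq0_le l n s A :
  (\sum_(n <= k <oo) (r k ^+ 2)%:E = s%:E)%E -> 0 <= l -> G n A ->
  (\int[P]_(t in A) (\1_[set t | Minf t = 0%R] t)%:E <=
   (expR (l ^+ 2 / 8 * s))%:E * \int[P]_(t in A) (expR (- l * M n t))%:E)%E.
Proof.
move=> sE l0 GA; have mA := Gm GA.
have V0 (X : T -> R) t : (0 <= (expR (- l * X t))%:E)%E by rewrite lee_fin expR_ge0.
apply: (@le_trans _ _ (\int[P]_(t in A) (expR (- l * Minf t))%:E)%E).
  apply: ge0_le_integral => //.
  - by apply/measurable_EFinP/measurable_indic.
  - by apply/measurable_EFinP/measurable_funTS/measurable_fun_expRM.
  - move=> t _; rewrite lee_fin indicE; case: (boolP (_ \in _)) => [|_].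
      by rewrite inE/= => ->; rewrite mulr0 expR0.
    exact: expR_ge0.
have cvgV : \forall t \ae P, A t ->
    (expR (- l * M (n + k)%N t))%:E @[k --> \oo] --> (expR (- l * Minf t))%:E.
  apply: filterS cvgM => t cMt _; apply: cvg_EFin; first by near=> k.
  apply: continuous_cvg; first exact: continuous_expR.
  apply: cvgMr; under eq_fun do rewrite addnC.
  by rewrite -(cvg_shiftn n) in cMt.
have [] := @dominated_convergence _ _ _ P A mA
  (fun k t => (expR (- l * M (n + k)%N t))%:E) (fun t => (expR (- l * Minf t))%:E)
  (EFin \o cst 1) _ _ cvgV.
- by move=> k; apply/measurable_EFinP/measurable_funTS/measurable_fun_expRM.
- by apply/measurable_EFinP/measurable_funTS/measurable_fun_expRM.
- exact: finite_measure_integrable_cst.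
- apply: aeW => t k _; rewrite gee0_abs// lee_fin -expR0 ler_expR mulNr oppr_le0.
  by rewrite mulr_ge0//; case/andP: (M01 (n + k) t).
move=> _ _ cvgI; apply: (cvge_to_le cvgI); near=> k.
apply: le_trans (hoeffding_iter k l0 GA) _.
rewrite lee_wpmul2r ?integral_ge0// lee_fin ler_expR ler_wpM2l ?divr_ge0 ?sqr_ge0//.
rewrite -lee_fin -sE -sumEFin (nneseries_split n k); last first.
  by move=> i _; rewrite lee_fin sqr_ge0.
by rewrite leeDl// nneseries_ge0// => i _ _; rewrite lee_fin sqr_ge0.
Unshelve. all: end_near. Qed.

Lemma cond_prob_limit_le n : \forall t \ae P, P0 n t <= exp_tail_bound r n (M n t).
Proof.
have [s sE s0] := fin_num_tail_sum n sum_r2.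
have bound l : 0 <= l ->
    \forall t \ae P, P0 n t <= expR (- (l * M n t) + l ^+ 2 / 8 * s).
  move=> l0; pose V t := expR (- (l * M n t) + l ^+ 2 / 8 * s).
  have VE t : V t = expR (l ^+ 2 / 8 * s) * expR (- l * M n t).
    by rewrite -expRD addrC mulNr.
  have [i1 iP0 mP0 P0I] := P0E n.
  have mV : measurable_wrt (G n) V.
    rewrite (funext VE); apply: measurable_funM => //.
    exact: (measurable_fun_expRM _ (@mGM n)).
  have iV : P.-integrable setT (EFin \o V).
    apply: measurable_bounded_integrable => //.
    - exact: le_lt_trans (probability_le1 P measurableT) (ltry _).
    - exact: (measurable_wrt_fun (sG n) (@Gm n) mV).
    - exists (expR (l ^+ 2 / 8 * s)); split; first exact: num_real.
      move=> x sx t _ /=; rewrite ger0_norm ?expR_ge0//; apply: le_trans (ltW sx).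
      by rewrite /V ler_expR gerDr oppr_le0 mulr_ge0//; case/andP: (M01 n t).
  apply: (ae_le_sub_sigma (sG n) (@Gm n) mP0 mV iP0 iV) => A GA.
  rewrite P0I//; under [leRHS]eq_integral do rewrite VE EFinM.
  rewrite ge0_integralZl//.
  - exact: integral_limit_eq0_le.
  - exact: Gm GA.
  - by apply/measurable_EFinP/measurable_funTS/measurable_fun_expRM.
(* The null set depends on [l], so only countably many values are kept before continuity is used. *)
have : \forall t \ae P, forall i j : nat,
    P0 n t <= expR (- (i%:R / j.+1%:R * M n t) + (i%:R / j.+1%:R) ^+ 2 / 8 * s).
  by apply: ae_foralln => i; apply: ae_foralln => j; apply: bound; exact: divr_ge0.
apply: filterS => t ht; case/andP: (M01 n t) => Mt0 _.
apply: (le_exp_tail_bound sE s0 Mt0).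
apply: (@ge0_le_fun_grid _ (fun l : R => expR (- (l * M n t) + l ^+ 2 / 8 * s))) => //.
move=> l; apply: continuous_comp; last exact: continuous_expR.
apply: cvgD; first by apply: cvgN; apply: cvgMl; exact: cvg_id.
by do 2!apply: cvgMl; exact: exprn_continuous.
Qed.

(** [P0 n] is an arbitrary version, hence nonnegative only almost surely. *)
Lemma cond_prob_limit_ge0 n : \forall t \ae P, 0 <= P0 n t.
Proof.
have [_ iP0 mP0 P0I] := P0E n.
apply: (@ae_le_sub_sigma _ _ _ _ _ (cst 0) _ (sG n) (@Gm n)) => //.
- exact: measurable_cst.
- exact: finite_measure_integrable_cst.
- by move=> A GA; rewrite P0I// integral0 integral_ge0.
Qed.

Lemma exp_tail_bound_sub_cond_prob_cvg0 :
  \forall t \ae P, exp_tail_bound r n (M n t) - P0 n t @[n --> \oo] --> 0.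
Proof.
have approx0 := @approx_limit_eq0 _ _ _ P G M Minf filG mGM
  (fun n t => proj1 (andP (M01 n t))) mMinf cvgM.
(* Taking [c = 1 / (j + 1)] leaves a single exceptional null set for all [j]. *)
have levy j : \forall t \ae P, Minf t = 0 ->
    \forall n \near \oo, 1 - j.+1%:R^-1 <= P0 n t.
  have j0 : 0 < j.+1%:R^-1 :> R by rewrite invr_gt0.
  exact: (levy_liminf_cond_prob filG m0 P0E approx0 j0).
have lev := ae_foralln levy.
have P0U := ae_foralln cond_prob_limit_le.
have P0_ge0 := ae_foralln cond_prob_limit_ge0.
apply: filterS3 cvgM lev (filterI P0U P0_ge0) => t cMt levt [P0Ut P0t].
have [Mt0|Mt_neq0] := eqVneq (Minf t) 0.
  apply/cvgrPdist_le => e e0.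
  have [j je] : exists j : nat, j.+1%:R^-1 <= e.
    by apply: (@filter_ex _ \oo); apply: (cvgr_le _ (@cvg_harmonic R)).
  (* Here [U0 - P0] is at most [1 - P0], hence at most [1 / (j + 1)] eventually. *)
  have := levt j Mt0; apply: filterS => n P0n.
  have [s sE s0] := fin_num_tail_sum n sum_r2.
  have /andP[_ U1] := exp_tail_bound_itv (M n t) sE s0.
  rewrite sub0r normrN ger0_norm ?subr_ge0//; apply: le_trans je.
  by rewrite lerBlDr; apply: le_trans U1 _; rewrite -lerBlDl.
have Mt_gt0 : 0 < Minf t.
  rewrite lt0r Mt_neq0; apply: (cvgr_to_ge cMt); near=> n.
  by case/andP: (M01 n t).
(* Here [0 <= U0 - P0 <= U0], and [U0] tends to 0 as [M n] has a positive limit. *)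
apply: squeeze_cvgr (cvg_cst 0) (exp_tail_bound_cvg0 sum_r2 cMt Mt_gt0).
by near=> n; rewrite subr_ge0 P0Ut lerBlDr lerDl P0t.
Unshelve. all: end_near. Qed.

End one_sided_bound.

Theorem proposition4p1 (d : measure_display) (T : measurableType d)
  (R : realType) (P : probability T R)
  (r : nat -> R) (hr : forall n, 0 <= r n < 1)
  (G : nat -> set_system T) (hG : filtration G)
  (M : nat -> T -> R) (hM : martingale P G M)
  (hM01 : forall n w, 0 <= M n w <= 1)
  (Y : nat -> {RV P >-> R})
  (hY01 : forall n w, 0 <= Y n.+1 w <= 1)
  (hY : forall n, is_cond_exp P (G n) (Y n.+1) (M n))
  (hdyn : forall n, \forall w \ae P,
     M n.+1 w = (1 - r n) * M n w + r n * Y n.+1 w)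
  (Minf : {RV P >-> R})
  (hMinf : \forall w \ae P, M n w @[n --> \oo] --> Minf w)
  (P0 P1 : nat -> T -> R)
  (hP0 : forall n, is_cond_prob P (G n) [set w | Minf w = 0] (P0 n))
  (hP1 : forall n, is_cond_prob P (G n) [set w | Minf w = 1] (P1 n))
  (hsum : (\sum_(0 <= n <oo) (r n ^+ 2)%:E < +oo)%E) :
  let U0 n w := exp_tail_bound r n (M n w) in
  let U1 n w := exp_tail_bound r n (1 - M n w) in
  [/\ forall n, \forall w \ae P, P0 n w <= U0 n w,
      forall n, \forall w \ae P, P1 n w <= U1 n w,
      \forall w \ae P, U0 n w - P0 n w @[n --> \oo] --> 0 &
      \forall w \ae P, U1 n w - P1 n w @[n --> \oo] --> 0].
Proof.
have [sG Gm _] := hG.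
(* The reflected data keep the same dynamics because the weights [1 - r n] and [r n] add up to 1. *)
have M01' n w : 0 <= 1 - M n w <= 1.
  by have /andP[M0 M1] := hM01 n w; rewrite subr_ge0 M1 gerBl M0.
have Y01' n w : 0 <= 1 - Y n.+1 w <= 1.
  by have /andP[Y0 Y1] := hY01 n w; rewrite subr_ge0 Y1 gerBl Y0.
have hY' n := is_cond_exp_onem (@Gm n) (hY n).
have hdyn' n : \forall w \ae P,
    1 - M n.+1 w = (1 - r n) * (1 - M n w) + r n * (1 - Y n.+1 w).
  by apply: filterS (hdyn n) => w ->; ring.
have mMinf : measurable_fun setT Minf by exact: measurable_funP.
have mMinf' : measurable_fun setT (fun w => 1 - Minf w) by exact: measurable_funB.
have hMinf' : \forall w \ae P, 1 - M n w @[n --> \oo] --> 1 - Minf w.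
  by apply: filterS hMinf => w Mw; apply: cvgB => //; exact: cvg_cst.
have hP1' n : is_cond_prob P (G n) [set w | 1 - Minf w = 0] (P1 n).
  suff -> : [set w | 1 - Minf w = 0] = [set w | Minf w = 1] by [].
  by apply/seteqP; split => w /= h; lra.
split.
- exact: (cond_prob_limit_le (Y := Y) hr hG hM01 hY01 hY hdyn mMinf hMinf hP0 hsum).
- exact: (cond_prob_limit_le (Y := fun n w => 1 - Y n w) hr hG M01' Y01' hY' hdyn'
    mMinf' hMinf' hP1' hsum).
- exact: (exp_tail_bound_sub_cond_prob_cvg0 (Y := Y) hr hG hM01 hY01 hY hdyn mMinf
    hMinf hP0 hsum).
- exact: (exp_tail_bound_sub_cond_prob_cvg0 (Y := fun n w => 1 - Y n w) hr hG M01' Y01'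
    hY' hdyn' mMinf' hMinf' hP1' hsum).
Qed.
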